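(* Let $(A,\mathfrak{m})$ be a local artinian ring and let $\zeta(A)=\zeta(A,\sim_A)$. Then $A$ is a principal ideal ring if and only if $\zeta(A)\simeq SG_k$, where $k$ is the nilpotency index of $\mathfrak{m}$.
   Context: All rings are commutative and unitary. For $a,b\in A$, $a\sim_A b$ iff $(a)=(b)$ as ideals. $\zeta(A,\sim_A)$ is the graph (loops allowed) with vertex set $A/\!\sim_A$ in which $[a],[b]$ are adjacent iff $ab=0$ (well defined). $\simeq$ denotes isomorphism of graphs (bijection on vertices preserving adjacency in both directions). For an integer $k\geq 0$, the staircase graph $SG_k$ has vertex set $\{0,\dots,k\}$, with $i$ adjacent to $j$ iff $i+j\geq k$ (loops, $i=j$, included). The nilpotency index of $\mathfrak{m}$ is the least $k\ge 1$ with $\mathfrak{m}^k=0$. *)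

(* Defs.v *)
From HB Require Import structures.
From mathcomp Require Import all_boot all_order all_algebra.
From mathcomp Require Import boolp classical_sets.

Set Implicit Arguments.
Unset Strict Implicit.
Unset Printing Implicit Defensive.

Import GRing.Theory.
Local Open Scope classical_set_scope.
Local Open Scope ring_scope.
Local Open Scope quotient_scope.

Section Ideals.
Variable A : comNzRingType.
Implicit Types (I J m : set A) (a b : A).

(* [idealr] of ring_quotient only covers proper ideals. *)
Definition is_ideal I : Prop :=
  [/\ I 0, (forall x y, I x -> I y -> I (x + y))
    & (forall a x, I x -> I (a * x))].

Definition principal a : set A := [set r * a | r in [set: A]].

Definition maximal_ideal m : Prop :=
  [/\ is_ideal m, m <> [set: A]
    & forall J, is_ideal J -> m `<=` J -> J <> [set: A] -> J = m].

Definition local_ring m : Prop :=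
  maximal_ideal m /\ forall n : set A, maximal_ideal n -> n = m.

Definition ideal_mul I J : set A :=
  smallest is_ideal [set z | exists x y, [/\ I x, J y & z = x * y]].

Definition ideal_pow I (k : nat) : set A := iter k (ideal_mul I) [set: A].

Definition is_nilpotency_index I (k : nat) : Prop :=
  [/\ (1 <= k)%N, ideal_pow I k = [set 0]
    & forall j : nat, (1 <= j)%N -> ideal_pow I j = [set 0] -> (k <= j)%N].

(* The value is 0 (not a possible index) when I is not nilpotent. *)
Definition nilpotency_index I : nat := xget 0%N (is_nilpotency_index I).

Lemma nilpotency_indexP I :
  (exists2 k : nat, (1 <= k)%N & ideal_pow I k = [set 0]) ->
  is_nilpotency_index I (nilpotency_index I).
Proof.
case=> k k_gt0 Ik0.
have exP : exists n, (1 <= n)%N && `[< ideal_pow I n = [set 0] >].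
  by exists k; rewrite k_gt0; apply/asboolP.
case: (ex_minnP exP) => n /andP[n_gt0 /asboolP In0] n_min.
rewrite /nilpotency_index; apply: (@xgetPex _ 0%N (is_nilpotency_index I)).
exists n; split=> // j j_gt0 Ij0; apply: n_min; rewrite j_gt0.
exact/asboolP.
Qed.

End Ideals.

Definition artinian (A : comNzRingType) : Prop :=
  forall I : nat -> set A,
    (forall n, is_ideal (I n)) -> (forall n, I n.+1 `<=` I n) ->
    exists N : nat, forall n : nat, (N <= n)%N -> I n = I N.

Definition principal_ideal_ring (A : comNzRingType) : Prop :=
  forall I : set A, is_ideal I -> exists a : A, I = principal a.

(* Undirected graphs, loops allowed. *)
Record graph := Graph {
  vertex : Type;
  adj : vertex -> vertex -> Prop;
  adj_sym : forall x y, adj x y -> adj y x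
}.

Definition graph_iso (G H : graph) : Prop :=
  exists f : vertex G -> vertex H,
    bijective f /\ forall x y, adj x y <-> adj (f x) (f y).

Definition staircase_adj (k : nat) (i j : 'I_k.+1) : Prop := (k <= i + j)%N.

Lemma staircase_adj_sym (k : nat) (i j : 'I_k.+1) :
  staircase_adj i j -> staircase_adj j i.
Proof. by rewrite /staircase_adj addnC. Qed.

Definition staircase (k : nat) : graph := Graph (@staircase_adj_sym k).

Section ZeroDivisorGraph.
Variable A : comNzRingType.

Definition sim (a b : A) : bool := `[< principal a = principal b >].

Lemma sim_refl : reflexive sim.
Proof. by move=> a; apply/asboolP. Qed.

Lemma sim_sym : symmetric sim.
Proof. by move=> a b; apply/asboolP/asboolP. Qed.

Lemma sim_trans : transitive sim.
Proof. by move=> b a c /asboolP ab /asboolP bc; apply/asboolP; rewrite ab. Qed.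

Canonical sim_equiv := EquivRel sim sim_refl sim_sym sim_trans.

Definition sim_class := {eq_quot sim_equiv}.

Definition zeta_adj (u v : sim_class) : Prop := repr u * repr v = 0.

Lemma zeta_adj_sym (u v : sim_class) : zeta_adj u v -> zeta_adj v u.
Proof. by rewrite /zeta_adj mulrC. Qed.

Definition zeta : graph := Graph zeta_adj_sym.

Lemma sim_eq0 (a a' b : A) : sim a a' -> a * b = 0 -> a' * b = 0.
Proof.
move=> /asboolP aa' ab0.
have : principal a' a' by exists 1; rewrite ?mul1r.
by rewrite -aa' => -[r _ <-]; rewrite -mulrA ab0 mulr0.
Qed.

(* Adjacency does not depend on the chosen representatives. *)
Lemma zeta_adj_pi (a b : A) :
  zeta_adj (\pi_sim_class a) (\pi_sim_class b) <-> a * b = 0.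
Proof.
have sim_repr (c : A) : sim (repr (\pi_sim_class c)) c.
  by apply/(@eqquotP _ sim_equiv sim_class); exact: reprK.
have sim_repr' c : sim c (repr (\pi_sim_class c)) by rewrite sim_sym.
rewrite /zeta_adj; split=> [|ab0].
  move=> /(sim_eq0 (sim_repr a)); rewrite mulrC => /(sim_eq0 (sim_repr b)).
  by rewrite mulrC.
apply: (sim_eq0 (sim_repr' a)); rewrite mulrC.
by apply: (sim_eq0 (sim_repr' b)); rewrite mulrC.
Qed.

End ZeroDivisorGraph.

(* Main.v *)
Require Import Defs.
From mathcomp Require Import all_boot all_order all_algebra.
From mathcomp Require Import boolp classical_sets.

(** Both directions rest on one counting principle.  If t_0, ..., t_{k-1} kill
    a nonzero product p_{k-1} = t_0 ... t_{k-2}, then the partial products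
    1 = p_0, p_1, ..., p_k = 0 generate a strictly decreasing chain of k + 1
    principal ideals ([partial_products_strict]).

    When A is principal, m = (t); as (t^n) stabilizes and 1 - rt is a unit,
    t is nilpotent, and the index k of m is the order of nilpotency of t.
    In a local ring an element outside m is a unit ([local_unit]), so every
    element is associated with exactly one of 1, t, ..., t^k = 0, and
    t^i t^j = 0 exactly when i + j >= k: this is the staircase graph.

    Conversely, an isomorphism with SG_k is used only through the number k + 1
    of its vertices.  Since m^(k-1) is nonzero, some product of k - 1 elements
    of m is nonzero ([ideal_pow_kills]), while m^k = 0, so the chain above
    consists of k + 1 distinct principal ideals and therefore of all of them.
    Hence the principal ideals are totally ordered by inclusion and finite in
    number, and any ideal is generated by the largest p_i it contains. *)

Set Implicit Arguments.
Unset Strict Implicit.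
Unset Printing Implicit Defensive.

Import GRing.Theory.
Local Open Scope classical_set_scope.
Local Open Scope ring_scope.
Local Open Scope quotient_scope.

Section Ideals.
Variable A : comNzRingType.
Implicit Types (I J m : set A) (a b c t : A).

(** * Units and nilpotents of a local ring *)

Lemma principal_ideal a : is_ideal (principal a).
Proof.
split; first by exists 0; rewrite ?mul0r.
  by move=> _ _ [r _ <-] [s _ <-]; exists (r + s); rewrite ?mulrDl.
by move=> b _ [r _ <-]; exists (b * r); rewrite ?mulrA.
Qed.

Lemma principal_id a : principal a a.
Proof. by exists 1; rewrite ?mul1r. Qed.

Lemma principal_sub I a : is_ideal I -> I a -> principal a `<=` I.
Proof. by case=> _ _ IM Ia _ [r _ <-]; exact: IM. Qed.

Lemma ideal1_full I : is_ideal I -> I 1 -> I = [set: A].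
Proof.
move=> [_ _ IM] I1; apply/seteqP; split=> // a _.
by rewrite -[a]mulr1; exact: IM.
Qed.

Lemma maximal_ideal_not1 m : maximal_ideal m -> ~ m 1.
Proof. by case=> mI mT _ m1; apply: mT; exact: ideal1_full. Qed.

(** Krull's theorem by Zorn's lemma.  The empty set is added to the proper
    ideals above I because the union of the empty chain must be admissible. *)
Lemma ideal_sub_maximal I :
  is_ideal I -> ~ I 1 -> exists2 n, maximal_ideal n & I `<=` n.
Proof.
move=> II I1.
pose P J := J = set0 \/ [/\ is_ideal J, I `<=` J & ~ J 1].
have [F FP Ftot|M [PM Mmax]] := @Zorn_bigcup A P.
  have [[J FJ J0]|F0] := pselect (exists2 J, F J & J <> set0); last first.
    left; apply/seteqP; split=> // x [J FJ Jx].
    by apply: F0; exists J => // J0; rewrite J0 in Jx.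
  have FI K x : F K -> K x -> [/\ is_ideal K, I `<=` K & ~ K 1].
    by move=> FK; case: (FP _ FK) => [->|//].
  have [//|[JI IJ _]] := FP _ FJ.
  right; split.
  - split; first by exists J => //; case: JI.
      move=> x y [K FK Kx] [L FL Ly].
      have [[_ KD _] _ _] := FI _ _ FK Kx; have [[_ LD _] _ _] := FI _ _ FL Ly.
      have [KL|LK] := Ftot _ _ FK FL.
        by exists L => //; apply: LD => //; exact: KL.
      by exists K => //; apply: KD => //; exact: LK.
    move=> a x [K FK Kx]; exists K => //.
    by have [[_ _ KM] _ _] := FI _ _ FK Kx; exact: KM.
  - by move=> x Ix; exists J => //; exact: IJ.
  - by move=> [K FK K1]; have [_ _] := FI _ _ FK K1; exact.
have [MI IM M1] : [/\ is_ideal M, I `<=` M & ~ M 1].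
  case: PM => // M0; case: (Mmax I); last by right; split.
  rewrite M0 properEneq; split=> //; apply/eqP => I0.
  by case: II; rewrite -I0.
exists M => //; split=> //; first by move=> MT; apply: M1; rewrite MT.
move=> J JI MJ JT; apply: contrapT => JM; apply: (Mmax J).
  by rewrite properEneq; split=> //; apply/eqP => /esym.
right; split=> //; first exact: subset_trans MJ.
by move=> J1; apply: JT; exact: ideal1_full.
Qed.

(** The principal ideal of a non-unit lies in some maximal ideal, and m is the
    only one. *)
Lemma local_unit m a : local_ring m -> ~ m a -> exists b, b * a = 1.
Proof.
move=> [_ m_uniq] ma; apply: contrapT => aN.
have a1 : ~ principal a 1 by move=> [b _ ba]; apply: aN; exists b.
have [n n_max an] := ideal_sub_maximal (principal_ideal a) a1.
by apply: ma; rewrite -(m_uniq n n_max); exact/an/principal_id.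
Qed.

(** Artinian form of Nakayama's lemma for one element: the chain of the
    ideals (t^n) stabilizes, so t^N (1 - rt) = 0 where 1 - rt is a unit. *)
Lemma local_artinian_nilpotent m t :
  local_ring m -> artinian A -> m t -> exists N, t ^+ N = 0.
Proof.
move=> m_local A_art mt.
have [N HN] : exists N, forall n, (N <= n)%N ->
    principal (t ^+ n) = principal (t ^+ N).
  apply: A_art => n; first exact: principal_ideal.
  apply: principal_sub; first exact: principal_ideal.
  by exists t; rewrite -?exprS.
have := principal_id (t ^+ N); rewrite -(HN N.+1) // => -[r _ tN].
exists N.
have [b b1] : exists b, b * (1 - r * t) = 1.
  apply: (local_unit m_local) => mr.
  have [m_max _] := m_local; apply: (maximal_ideal_not1 m_max).
  have [[_ mD mM] _ _] := m_max.
  by rewrite -(subrK (r * t) 1); apply: mD => //; exact: mM.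
by rewrite -[LHS]mul1r -b1 -mulrA mulrBl mul1r -mulrA -exprS tN subrr mulr0.
Qed.

(** * Powers of an ideal and products of its elements *)

Lemma ideal_pow_prod m n (s : nat -> A) :
  is_ideal m -> (forall i, (i < n)%N -> m (s i)) ->
  ideal_pow m n (\prod_(i < n) s i).
Proof.
move=> mI; elim: n => [//|n IHn] ms.
rewrite big_ord_recr /= mulrC; apply: sub_gen_smallest.
exists (s n), (\prod_(i < n) s i); split=> //; first exact: ms.
by apply: IHn => i ltin; exact/ms/ltnW.
Qed.

(** A power of m is generated by products of elements of m, so whatever
    annihilates those annihilates the power.  The factor c absorbs one element
    of m at each step of the induction. *)
Lemma ideal_pow_kills m n c :
  (forall s : nat -> A, (forall i, (i < n)%N -> m (s i)) ->
     c * \prod_(i < n) s i = 0) ->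
  forall x, ideal_pow m n x -> c * x = 0.
Proof.
elim: n c => [|n IHn] c c0 x.
  move=> _; have := c0 (fun=> 0); rewrite big_ord0 mulr1 => -> //.
  by rewrite mul0r.
apply: (@smallest_sub _ _ _ [set z | c * z = 0]).
  split=> [|y z /= cy cz|a y /= cy]; first by rewrite /= mulr0.
    by rewrite mulrDr cy cz addr0.
  by rewrite mulrCA cy mulr0.
move=> _ [y [z [my mz ->]]] /=; rewrite mulrA.
apply: IHn mz => s ms.
have := c0 (fun i => if i is j.+1 then s j else y).
by rewrite big_ord_recl /= mulrA; apply; case.
Qed.

Lemma ideal_pow0P m n :
  is_ideal m ->
  ideal_pow m n = [set 0] <->
  forall s : nat -> A, (forall i, (i < n)%N -> m (s i)) ->
    \prod_(i < n) s i = 0.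
Proof.
move=> mI; split=> [mn0 s ms|s0].
  by have := ideal_pow_prod mI ms; rewrite mn0.
apply/seteqP; split=> [x mx|_ ->] /=.
  by rewrite -[x]mul1r; apply: ideal_pow_kills mx => s ms; rewrite mul1r s0.
case: n s0 => [_|n s0]; first by [].
have m0 i : (i < n.+1)%N -> m 0 by case: mI.
by have := ideal_pow_prod mI m0; rewrite (s0 (fun=> 0)).
Qed.

Lemma ideal_pow_principal0 t n :
  ideal_pow (principal t) n = [set 0] <-> t ^+ n = 0.
Proof.
rewrite (ideal_pow0P _ (principal_ideal t)); split=> [/(_ (fun=> t))|tn0 s ms].
  by rewrite prodr_const card_ord; apply=> i _; exact: principal_id.
suff [r ->] : exists r, \prod_(i < n) s i = r * t ^+ n by rewrite tn0 mulr0.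
elim: n {tn0} ms => [_|n IHn ms]; first by exists 1; rewrite big_ord0 mulr1.
have [i ltin|r rE] := IHn; first exact/ms/ltnW.
have [u _ uE] := ms n (ltnSn n).
by exists (r * u); rewrite big_ord_recr /= rE -uE exprSr mulrACA.
Qed.

Lemma nilpotency_index_pred_neq0 m k :
  is_nilpotency_index m k -> ideal_pow m k.-1 <> [set 0].
Proof.
case=> k_gt0 _ k_min mk0.
have [k1|k1] := posnP k.-1.
  have : [set 0] (1 : A) by rewrite -mk0 k1.
  by move=> /= /eqP; rewrite oner_eq0.
by have := k_min _ k1 mk0; rewrite leqNgt prednK // leqnn.
Qed.

(** * Strict chains of partial products *)

(** If p_i were a multiple of p_j with i < j, multiplying by the factors that
    complete p_i to p_{k-1} would make p_{k-1} a multiple of t_i p_{k-1} = 0. *)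
Lemma partial_products_strict (s : nat -> A) k i j :
  \prod_(l < k.-1) s l != 0 ->
  (forall l, (l < k)%N -> s l * \prod_(l < k.-1) s l = 0) ->
  (i < j <= k)%N -> ~ principal (\prod_(l < j) s l) (\prod_(l < i) s l).
Proof.
move=> pN0 sp /andP[ltij lejk] [r _ pij].
have ltik : (i < k)%N by exact: leq_trans lejk.
have leik : (i <= k.-1)%N by rewrite -ltnS prednK // (leq_ltn_trans _ ltik).
have pcat n : (i <= n)%N ->
    \prod_(l < n) s l = \prod_(l < i) s l * \prod_(i <= l < n) s l.
  by move=> lein; rewrite -!(big_mkord xpredT s) -big_cat_nat.
case/eqP: pN0; rewrite (pcat _ leik) -pij (pcat _ (ltnW ltij)) big_ltn //.
have := sp i ltik; rewrite (pcat _ leik).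
set p := \prod_(l < i) _; set q := \prod_(i <= l < k.-1) _.
set w := \prod_(i.+1 <= l < j) _ => spq.
transitivity (r * w * (s i * (p * q))); last by rewrite spq mulr0.
rewrite -!mulrA; congr (_ * _).
by rewrite [in RHS]mulrCA [p * (s i * _)]mulrCA (mulrCA p).
Qed.

Lemma pi_eq a b :
  (\pi_(sim_class A) a = \pi_(sim_class A) b) <-> principal a = principal b.
Proof.
split=> [/eqP|ab]; first by rewrite eqmodE => /asboolP.
by apply/eqP; rewrite eqmodE; apply/asboolP.
Qed.

Lemma partial_products_pi_inj (s : nat -> A) k :
  \prod_(l < k.-1) s l != 0 ->
  (forall l, (l < k)%N -> s l * \prod_(l < k.-1) s l = 0) ->
  injective (fun i : 'I_k.+1 => \pi_(sim_class A) (\prod_(l < i) s l)).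
Proof.
move=> pN0 sp.
have strict (i j : 'I_k.+1) : (i < j)%N ->
    principal (\prod_(l < i) s l) <> principal (\prod_(l < j) s l).
  move=> ltij pij; have ijk : (i < j <= k)%N by rewrite ltij -ltnS ltn_ord.
  apply: (partial_products_strict pN0 sp ijk).
  by rewrite -pij; exact: principal_id.
move=> i j /pi_eq pij; apply: val_inj => /=.
by have [/strict|/strict/nesym|] := ltngtP i j.
Qed.

(** * From a principal ideal ring to the staircase *)

(** The exponent is the last i for which a still lies in (t^i): the cofactor
    of t^i is then outside m, hence a unit. *)
Lemma local_principal_power m t k a :
  local_ring m -> m = principal t -> t ^+ k = 0 ->
  exists i : 'I_k.+1, principal a = principal (t ^+ i).
Proof.
move=> m_local mE tk0.
have [->|aN0] := eqVneq a 0; first by exists ord_max; rewrite tk0.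
have exP : exists i, `[< principal (t ^+ i) a >].
  by exists 0%N; apply/asboolP; exists a; rewrite ?mulr1.
have bound i : `[< principal (t ^+ i) a >] -> (i <= k)%N.
  move=> /asboolP[r _ ra]; rewrite leqNgt; apply: contraNN aN0 => ltki.
  by rewrite -ra -(subnK (ltnW ltki)) exprD tk0 !mulr0.
have [i /asboolP ia i_max] := ex_maxnP exP bound.
have ltik : (i < k.+1)%N by rewrite ltnS; apply: bound; exact/asboolP.
exists (Ordinal ltik) => /=; apply/seteqP.
split; apply: principal_sub => //; try exact: principal_ideal.
case: ia => r _ ra.
have [b br] : exists b, b * r = 1.
  apply: (local_unit m_local); rewrite mE => -[u _ ur].
  suff /i_max : `[< principal (t ^+ i.+1) a >] by rewrite ltnn.
  by apply/asboolP; exists u => //; rewrite exprS mulrA ur.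
by exists b; rewrite // -ra mulrA br mul1r.
Qed.

Lemma principal_ring_staircase m :
  local_ring m -> artinian A -> principal_ideal_ring A ->
  graph_iso (zeta A) (staircase (nilpotency_index m)).
Proof.
move=> m_local A_art A_pir.
have [m_max _] := m_local; have [mI _ _] := m_max.
have [t mE] := A_pir m mI.
have mt : m t by rewrite mE; exact: principal_id.
have [N tN0] := local_artinian_nilpotent m_local A_art mt.
have m_nil : is_nilpotency_index m (nilpotency_index m).
  apply: nilpotency_indexP; exists N; last by rewrite mE ideal_pow_principal0.
  by case: N tN0 => // /eqP; rewrite expr0 oner_eq0.
move: (nilpotency_index m) m_nil => k m_nil.
have [k_gt0 mk0 _] := m_nil.
have tk0 : t ^+ k = 0 by rewrite -ideal_pow_principal0 -mE.
have tk1 : t ^+ k.-1 != 0.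
  apply/eqP; rewrite -ideal_pow_principal0 -mE.
  exact: nilpotency_index_pred_neq0.
have t0 n : t ^+ n = 0 <-> (k <= n)%N.
  split=> [tn0|lekn]; last by rewrite -(subnK lekn) exprD tk0 mulr0.
  rewrite leqNgt; apply: contraNN tk1 => ltnk.
  have lenk : (n <= k.-1)%N by rewrite -ltnS prednK.
  by rewrite -(subnK lenk) exprD tn0 mulr0.
have prodE n : \prod_(l < n) t = t ^+ n by rewrite prodr_const card_ord.
pose g (i : 'I_k.+1) := \pi_(sim_class A) (t ^+ i).
have g_inj : injective g.
  move=> i j gij; apply: (@partial_products_pi_inj (fun=> t) k).
  - by rewrite prodE.
  - by move=> l _; rewrite prodE -exprS prednK.
  - by rewrite /= !prodE.
have /choice[f fK] : forall u : sim_class A, exists i, g i = u.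
  move=> u; have [i ui] := local_principal_power (repr u) m_local mE tk0.
  by exists i; rewrite -[u]reprK; apply/pi_eq.
exists f; split; first by exists g => // i; exact: g_inj.
move=> u v; have := zeta_adj_pi (t ^+ f u) (t ^+ f v).
by rewrite -!/(g _) !fK -exprD => uv; exact: iff_trans (t0 _).
Qed.

(** * From the staircase to a principal ideal ring *)

(** Were m not nilpotent, its index would be the default value 0, and the
    single vertex of SG_0 would identify the classes of 0 and 1. *)
Lemma staircase_index m :
  graph_iso (zeta A) (staircase (nilpotency_index m)) ->
  is_nilpotency_index m (nilpotency_index m).
Proof.
move=> [f [/bij_inj f_inj _]].
have [exk|nok] := pselect (exists k, is_nilpotency_index m k).
  exact: (@xgetPex _ 0%N (is_nilpotency_index m)).
move: f f_inj; rewrite /nilpotency_index xgetPN; last first.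
  by move=> k mk; apply: nok; exists k.
move=> f f_inj; have /f_inj/pi_eq p01 :
  f (\pi_(sim_class A) 0) = f (\pi_(sim_class A) 1) by rewrite !ord1.
have := principal_id (1 : A); rewrite -p01 => -[r _ /esym/eqP].
by rewrite mulr0 oner_eq0.
Qed.

Lemma staircase_principal_ring m :
  is_ideal m -> graph_iso (zeta A) (staircase (nilpotency_index m)) ->
  principal_ideal_ring A.
Proof.
move=> mI iso; have := staircase_index iso; move: iso.
move: (nilpotency_index m) => k [f [f_bij _]] m_nil.
have [k_gt0 mk0 _] := m_nil.
have [s ms pN0] : exists2 s : nat -> A, (forall i, (i < k.-1)%N -> m (s i)) &
    \prod_(i < k.-1) s i != 0.
  apply: contrapT => no_s; apply: (nilpotency_index_pred_neq0 m_nil).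
  apply/(ideal_pow0P _ mI) => s ms; apply/eqP/negPn/negP => pN0.
  by apply: no_s; exists s.
(* Position k - 1 is free: the value 0 there makes the last product p_k zero,
   so that the chain ends with the zero ideal. *)
pose s' l := if (l < k.-1)%N then s l else 0.
have ms' l : m (s' l) by rewrite /s'; case: ifP => [/ms//|_]; case: mI.
have ps' : \prod_(l < k.-1) s' l = \prod_(l < k.-1) s l.
  by apply: eq_bigr => l _; rewrite /s' ltn_ord.
have ps'N0 : \prod_(l < k.-1) s' l != 0 by rewrite ps'.
have s'p l : (l < k)%N -> s' l * \prod_(l < k.-1) s' l = 0.
  move=> _; move: mk0; rewrite -(prednK k_gt0) => /(ideal_pow0P _ mI) mk0.
  have := mk0 (fun i => if i is j.+1 then s' j else s' l).
  by rewrite big_ord_recl /=; apply; case.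
pose p i := \prod_(l < i) s' l.
have g_inj := partial_products_pi_inj ps'N0 s'p.
(* An injective self-map of the k + 1 vertices is onto: the chain exhausts the
   principal ideals. *)
have p_onto a : exists i : 'I_k.+1, principal a = principal (p i).
  have fg_inj := inj_comp (bij_inj f_bij) g_inj.
  have [h _ hK] := injF_bij fg_inj.
  exists (h (f (\pi_(sim_class A) a))); apply/pi_eq/(bij_inj f_bij).
  by rewrite -[LHS]hK.
have p_anti i j : (i <= j)%N -> principal (p j) `<=` principal (p i).
  move=> leij; apply: principal_sub; first exact: principal_ideal.
  exists (\prod_(i <= l < j) s' l) => //.
  by rewrite mulrC /p -!(big_mkord xpredT s') -big_cat_nat.
move=> I II; have [I0 _ _] := II.
have exP : exists i, `[< I (p i) >].
  have [i pi0] := p_onto 0; exists i; apply/asboolP.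
  by apply: (principal_sub II I0); rewrite pi0; exact: principal_id.
have [i /asboolP Ii i_min] := ex_minnP exP.
exists (p i); apply/seteqP; split; last exact: principal_sub.
move=> a Ia; have [j aj] := p_onto a.
apply: (p_anti i j); last by rewrite -aj; exact: principal_id.
apply: i_min; apply/asboolP; apply: (principal_sub II Ia).
by rewrite aj; exact: principal_id.
Qed.

End Ideals.

Theorem proposition4p6 (A : comNzRingType) (m : set A)
    (m_local : local_ring m) (A_artinian : artinian A) :
  principal_ideal_ring A <->
  graph_iso (zeta A) (staircase (nilpotency_index m)).
Proof.
split; first exact: principal_ring_staircase.
by case: m_local => [[mI _ _] _]; exact: staircase_principal_ring.
Qed.
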